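(* Let $K>2$, let $\{b\}$ be a blocking set of $B>2$ indices, and let $i,j\in\{b\}$ be distinct. Suppose, for every $k\in\{1,\dots,K\}$, that $n_{k\backslash b}>0$, $S_{\{k\backslash b\}}$ is non-singular and $\overline{Y}_{\{k\backslash b\}}\ne0$, and let $d_k$ scale $\overline{Y}_{\{k\backslash b\}}$ as described in the context. Let $d_1,\dots,d_K\to\infty$ with $d_l=\mathcal{O}(d_m)$ for all $l,m\in\{1,\dots,K\}$ (so that, for every allocation of the blocked observations, the distance from the mean of the blocked observations allocated to component $k$ to the component mean $d_k\overline{Y}_{\{k\backslash b\}}$ increases without bound). Then for any $1\le k'<K$, with $p^{\{b\}}_{11},p^{\{b\}}_{12},p^{\{b\}}_{21},p^{\{b\}}_{22}$ the probabilities (defined in the context) of the partition of the joint distribution of $(C_i,C_j)$ induced by $I(\cdot\le k')$, $$\frac{p_{11}^{\{b\}}-p_{1\cdot}^{\{b\}}p_{\cdot1}^{\{b\}}}{(p_{11}^{\{b\}}+p_{12}^{\{b\}})(p_{21}^{\{b\}}+p_{22}^{\{b\}})}\to1,$$ and consequently $$\rho_{\tilde\pi}(C_{\{b\}})\to1 .$$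
   Context: Data $Y_1,\dots,Y_N\in\mathbb{R}^D$ are modelled by a $K$-component collapsed Bayesian Gaussian mixture with latent allocations $C_n\in\{1,\dots,K\}$. $\{b\}=\{i_1,\dots,i_B\}$ is a set of indices and the allocations $C_n$, $n\notin\{b\}$, are fixed. For each $k$: $\{k\backslash b\}=\{n\notin\{b\}:C_n=k\}$, $n_{k\backslash b}$ is its cardinality, $\overline{Y}_{\{k\backslash b\}}$ is the mean of the $Y_n$, $n\in\{k\backslash b\}$, and $$S_{\{k\backslash b\}}=\Sigma_0+\sum_{n\in\{k\backslash b\}}(Y_n-\overline{Y}_{\{k\backslash b\}})(Y_n-\overline{Y}_{\{k\backslash b\}})^T,$$ with $\Sigma_0$ positive definite. The prior on the component means is flat ($\kappa_0=0$). The data are translated so that $\tfrac12(Y_i+Y_j)=0$. Scale factors $d_k>0$ multiply the component means: $\overline{Y}_{\{k\backslash b\}}$ is replaced by $d_k\overline{Y}_{\{k\backslash b\}}$, while $S_{\{k\backslash b\}}$ and the blocked observations $Y_n$, $n\in\{b\}$, stay fixed. For an allocation $c\in\{1,\dots,K\}^{\{b\}}$ of the blocked observations, let $\{b_k\}=\{n\in\{b\}:c_n=k\}$, $q_k=|\{b_k\}|$, $\overline{Y}_{\{b_k\}}$ the mean of $Y_n$, $n\in\{b_k\}$, $V_{b_k}=\sum_{n\in\{b_k\}}(Y_n-\overline{Y}_{\{b_k\}})(Y_n-\overline{Y}_{\{b_k\}})^T$, and $$S_k(c)=S_{\{k\backslash b\}}+V_{b_k}+\frac{q_k\,n_{k\backslash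 b}}{n_{k\backslash b}+q_k}\bigl(\overline{Y}_{\{b_k\}}-d_k\overline{Y}_{\{k\backslash b\}}\bigr)\bigl(\overline{Y}_{\{b_k\}}-d_k\overline{Y}_{\{k\backslash b\}}\bigr)^T$$ (with $S_k(c)=S_{\{k\backslash b\}}$ if $q_k=0$). The conditional distribution $\tilde\pi$ of $C_{\{b\}}=(C_n)_{n\in\{b\}}$ given the fixed allocation of the other latent variables is proportional to $$w(c)=\prod_{k=1}^K\frac{\Gamma(\beta+n_{k\backslash b}+q_k)\prod_{r=1}^D\Gamma(\nu_0+n_{k\backslash b}+q_k+1-r)}{|S_k(c)|^{(\nu_0+n_{k\backslash b}+q_k)/2}\,(n_{k\backslash b}+q_k)^{D/2}},$$ where $|\cdot|$ is the determinant and $\beta,\nu_0>0$ are such that all gamma-function arguments are positive. Let $u^{\{b\}}_{lm}=\sum_{c:\,c_i=l,\,c_j=m}w(c)$ (the unnormalized joint distribution of $(C_i,C_j)$ under $\tilde\pi$), and $$p_{11}^{\{b\}}=\gamma\sum_{l\le k',\,m\le k'}u^{\{b\}}_{lm},\quad p_{22}^{\{b\}}=\gamma\sum_{l>k',\,m>k'}u^{\{b\}}_{lm},\quad p_{21}^{\{b\}}=\gamma\sum_{l>k',\,m\le k'}u^{\{b\}}_{lm},\quad p_{12}^{\{b\}}=\gamma\sum_{l\le k',\,m>k'}u^{\{b\}}_{lm},$$ with $\gamma>0$ the normalizing constant making these sum to $1$; $p_{1\cdot}^{\{b\}}=p_{11}^{\{b\}}+p_{12}^{\{b\}}$ and $p_{\cdot1}^{\{b\}}=p_{11}^{\{b\}}+p_{21}^{\{b\}}$.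 Reversible Gibbs sampling on $C_{\{b\}}$: one iteration consists of a forward pass, resampling $C_{i_1},\dots,C_{i_B}$ in this order, each from its conditional distribution under $\tilde\pi$ given the current values of the other blocked variables, followed by a backward pass resampling in the reverse order $C_{i_B},\dots,C_{i_1}$. The transition operator is self-adjoint on $L^2(\tilde\pi)$, and the convergence rate $\rho_{\tilde\pi}(C_{\{b\}})$ is its spectral radius on the mean-zero functions in $L^2(\tilde\pi)$. *)

(* Defs.v *)
From HB Require Import structures.
From mathcomp Require Import all_boot all_order all_algebra.
From mathcomp Require Import all_classical all_reals all_analysis.
From mathcomp Require Export complex.

Set Implicit Arguments.
Unset Strict Implicit.
Unset Printing Implicit Defensive.

Import Order.TTheory GRing.Theory Num.Theory.
Import numFieldNormedType.Exports.
Import ComplexField.Normc.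

Local Open Scope ring_scope.
Local Open Scope classical_set_scope.
Local Open Scope complex_scope.

Section Moments.
Variables (R : realType) (D : nat).

Definition Gamma (a : R) : R :=
  \int[lebesgue_measure]_(x in `]0, +oo[) (x `^ (a - 1) * expR (- x)).

Definition posdefmx (M : 'M[R]_D) : Prop :=
  M^T = M /\ forall x : 'cV[R]_D, x != 0 -> 0 < (x^T *m M *m x) ord0 ord0.

Definition mean (I : finType) (A : {set I}) (y : I -> 'cV[R]_D) : 'cV[R]_D :=
  #|A|%:R^-1 *: \sum_(n in A) y n.

Definition scatter (I : finType) (A : {set I}) (y : I -> 'cV[R]_D) : 'M[R]_D :=
  \sum_(n in A) (y n - mean A y) *m (y n - mean A y)^T.

End Moments.

(* The block is given by its enumeration [b : 'I_B -> 'I_N] (injective in the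
   theorem): the blocked index i_s is [b s].  An allocation of the blocked
   observations is indexed by the positions s, and components are numbered
   from 0 to K - 1. *)
Definition alloc (B K : nat) := {ffun 'I_B -> 'I_K}.

Section Mixture.
Variables (R : realType) (D N B K : nat).
Variables (Y : 'I_N -> 'cV[R]_D) (b : 'I_B -> 'I_N).
(* Only the values of [C] outside the block are used. *)
Variable C : 'I_N -> 'I_K.
Variables (Sigma0 : 'M[R]_D) (beta nu0 : R).

Definition unblocked (k : 'I_K) : {set 'I_N} :=
  [set n | (n \notin codom b) && (C n == k)]%SET.

Definition n_unblocked (k : 'I_K) : nat := #|unblocked k|.

Definition Ybar_unblocked (k : 'I_K) : 'cV[R]_D := mean (unblocked k) Y.

Definition S_unblocked (k : 'I_K) : 'M[R]_D := Sigma0 + scatter (unblocked k) Y.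

Definition blocked (c : alloc B K) (k : 'I_K) : {set 'I_B} :=
  [set s | c s == k]%SET.

Definition n_blocked (c : alloc B K) (k : 'I_K) : nat := #|blocked c k|.

Definition Ybar_blocked (c : alloc B K) (k : 'I_K) : 'cV[R]_D :=
  mean (blocked c k) (Y \o b).

Definition S_full (d : 'I_K -> R) (c : alloc B K) (k : 'I_K) : 'M[R]_D :=
  let n := n_unblocked k in
  let q := n_blocked c k in
  let delta := Ybar_blocked c k - d k *: Ybar_unblocked k in
  if q == 0%N then S_unblocked k
  else S_unblocked k + scatter (blocked c k) (Y \o b)
       + (q%:R * n%:R / (n + q)%:R) *: (delta *m delta^T).

Definition weight (d : 'I_K -> R) (c : alloc B K) : R :=
  \prod_(k < K)
    let m := (n_unblocked k + n_blocked c k)%N in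
    (Gamma (beta + m%:R) * \prod_(1 <= r < D.+1) Gamma (nu0 + m%:R + 1 - r%:R))
    / ((\det (S_full d c k)) `^ ((nu0 + m%:R) / 2) * m%:R `^ (D%:R / 2)).

End Mixture.

Section PairPartition.
Variables (R : realType) (B K : nat).
Variables (w : alloc B K -> R) (i j : 'I_B) (k' : nat).

Definition pair_weight (l m : 'I_K) : R :=
  \sum_(c : alloc B K | (c i == l) && (c j == m)) w c.

Definition pair_norm : R := (\sum_(l < K) \sum_(m < K) pair_weight l m)^-1.

(* The component with 0-based number l has label l + 1, so "label <= k'" reads
   [l < k'] and "label > k'" reads [k' <= l]. *)
Definition p11 : R :=
  pair_norm * \sum_(l < K | (l < k')%N) \sum_(m < K | (m < k')%N) pair_weight l m.
Definition p22 : R :=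
  pair_norm * \sum_(l < K | (k' <= l)%N) \sum_(m < K | (k' <= m)%N) pair_weight l m.
Definition p21 : R :=
  pair_norm * \sum_(l < K | (k' <= l)%N) \sum_(m < K | (m < k')%N) pair_weight l m.
Definition p12 : R :=
  pair_norm * \sum_(l < K | (l < k')%N) \sum_(m < K | (k' <= m)%N) pair_weight l m.

Definition p1_ : R := p11 + p12.
Definition p_1 : R := p11 + p21.

End PairPartition.

Section Gibbs.
Variables (R : realType) (B K : nat).

Definition normalize (w : alloc B K -> R) (c : alloc B K) : R :=
  w c / \sum_(c' : alloc B K) w c'.

Variable pi : alloc B K -> R.

Definition update (c : alloc B K) (s : 'I_B) (k : 'I_K) : alloc B K :=
  [ffun r => if r == s then k else c r].

Definition full_conditional (s : 'I_B) (c : alloc B K) (k : 'I_K) : R :=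
  pi (update c s k) / \sum_(k0 < K) pi (update c s k0).

Definition resample (s : 'I_B) (f : alloc B K -> R[i]) (c : alloc B K) : R[i] :=
  \sum_(k < K) (full_conditional s c k)%:C * f (update c s k).

(* E[f(state after resampling the sites of ss in this order) | start in c];
   the site resampled first gives the outermost operator. *)
Definition sweep (ss : seq 'I_B) (f : alloc B K -> R[i]) : alloc B K -> R[i] :=
  foldr resample f ss.

Definition gibbs_operator : (alloc B K -> R[i]) -> alloc B K -> R[i] :=
  sweep (enum 'I_B ++ rev (enum 'I_B)).

Definition mean_zero (f : alloc B K -> R[i]) : Prop :=
  \sum_(c : alloc B K) (pi c)%:C * f c = 0.

Definition gibbs_eigenvalue (lambda : R[i]) : Prop :=
  exists f : alloc B K -> R[i],
    [/\ mean_zero f, exists c, f c != 0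
      & forall c, gibbs_operator f c = lambda * f c].

(* The state space is finite and pi is positive on it, so (complex) L^2(pi) is
   the space of all functions, and the spectrum of the operator on its
   finite-dimensional mean-zero subspace is the set of eigenvalues there. *)
Definition gibbs_rate : R :=
  sup [set r : R | exists2 lambda, gibbs_eigenvalue lambda & r = normc lambda].

End Gibbs.

(* Main.v *)
Require Import Defs.
From HB Require Import structures.
From mathcomp Require Import all_boot all_order all_algebra.
From mathcomp Require Import all_classical all_reals all_analysis.
From mathcomp Require Import measurable_realfun spectral ring lra.

(** The scales d_k diverge at comparable rates. A component which receives q
    blocked observations has a scatter matrix that is the sum of a fixed positive
    definite matrix and of a rank one matrix of order d_k^2; by the rank one
    update formula its determinant is of order d_k^2 exactly. Hence the weight of an
    allocation c is, up to a factor with a positive limit, the inverse of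

      product over the occupied components k of d_k^(nu0 + n_k)
      times the product over the blocked sites s of d_(c s)

    ([weight_asymptotics]). If c occupies several components and k is one of
    them, merging the whole block into k changes the second product by a bounded
    factor and removes at least one diverging factor from the first one. So the
    weight of c is negligible with respect to that of the allocation constantly
    equal to k ([weight_ratio_to0]), although the various constant allocations
    need not be of the same order among themselves.

    An allocation counted in p12 or in p21 puts i and j in different components,
    one on each side of the cut. It can be merged into either one, so that p12
    and p21 are negligible with respect to both p11 and p22. The quotient of the
    theorem equals 1 - p21 / (p21 + p22) - p12 / (p11 + p12), whence the first
    limit ([pair_ratio_bounds]).

    For the Gibbs sampler, the event that C_i lies below the cut is a bottleneck.
    Only the resampling of site i can leave it, and a move of i across the cut
    starts or ends in an allocation where i and j lie on different sides; by
    reversibility the mass of such moves is at most p12 + p21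
    ([leave_mass_le]), hence negligible with respect to the mass of the event and
    to that of its complement. The centred indicator f of the event therefore has
    a Rayleigh quotient close to 1: if u is the image of f under the backward
    pass, the quotient is <u, u> / <f, f>, and <u, u> >= 2 Re <u, f> - <f, f>,
    where <u, f> only involves the resampling of i ([gibbs_rate_ge_leave]). The
    spectral theorem yields an eigenvalue on the mean-zero functions of modulus
    at least this quotient ([gibbs_rate_ge_rayleigh]), and no eigenvalue exceeds 1
    in modulus because resampling averages ([gibbs_rate_le1]).

    All this needs the weights to be positive, hence the positivity of the
    determinants ([posdefmx_det_gt0]) and of the gamma function ([Gamma_gt0]),
    the latter being in essence the convergence of Euler's integral. *)

Set Implicit Arguments.
Unset Strict Implicit.
Unset Printing Implicit Defensive.

Import Order.TTheory GRing.Theory Num.Theory.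
Import numFieldNormedType.Exports.
Import ComplexField.Normc.

Local Open Scope ring_scope.
Local Open Scope classical_set_scope.

(** * Positivity of the gamma function *)

Section GammaPositive.
Variable R : realType.
Local Notation mu := (@lebesgue_measure R).

(** The inequality ln y <= y - 1 at y = x / (2 a). *)
Lemma powR_le_expR_half (a x : R) : 0 < a -> 0 < x ->
  x `^ a <= (2 * a) `^ a * expR (x / 2).
Proof.
move=> a0 x0; have s0 : 0 < 2 * a by rewrite mulr_gt0.
rewrite /powR !gt_eqF// -expRD ler_expR.
have /le_ln1Dx : -1 < x / (2 * a) - 1 by rewrite ltrBrDr addNr divr_gt0.
rewrite addrC subrK ln_div ?posrE// lerBlDr => h.
have := ler_wpM2l (ltW a0) h; rewrite mulrDr mulrBr => /le_trans; apply.
rewrite mulr1 [X in X - a]mulrC.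
have -> : x / (2 * a) * a = x / 2 by field; rewrite gt_eqF.
lra.
Qed.

(** Up to a constant this dominates the gamma integrand near 0 and near infinity
    at once, and its primitive below is bounded. *)
Definition gamma_majorant (a x : R) : R := a * x `^ (a - 1) / (1 + x `^ a) ^+ 2.
Definition gamma_primitive (a x : R) : R := - (1 + x `^ a)^-1.

Lemma is_derive_gamma_primitive (a x : R) : 0 < x -> 
  is_derive x 1 (gamma_primitive a) (gamma_majorant a x).
Proof.
move=> x0; have h := is_derive1_powR a x0.
have h1 : is_derive x 1 (fun x => 1 + x `^ a) (a * x `^ (a - 1)).
  by have := is_deriveD (is_derive_cst (1:R) x 1) h; rewrite add0r; apply.
have n0 : 1 + x `^ a != 0 by rewrite gt_eqF// ltr_pwDl// powR_ge0.
apply: (is_derive_eq (is_deriveN (@is_deriveV _ (fun x : R => 1 + x `^ a) x _ _ n0 h1))).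
by rewrite scaleNr opprK /gamma_majorant [RHS]mulrC.
Qed.

Lemma continuous_gamma_majorant (a x : R) : 0 < x ->
  {for x, continuous (gamma_majorant a)}.
Proof.
move=> x0.
have cp b : {for x, continuous (fun x : R => x `^ b)}.
  apply/differentiable_continuous/derivable1_diffP.
  by have [] := is_derive1_powR b x0.
apply: cvgM; first by apply: cvgM; [exact: cvg_cst|exact: cp].
apply: cvgV; first by rewrite expf_neq0// gt_eqF// ltr_pwDl// powR_ge0.
rewrite expr2.
by apply: cvgM; apply: cvgD; [exact: cvg_cst|exact: cp|exact: cvg_cst|exact: cp].
Qed.

Lemma integral_gamma_majorant_le1 (a u v : R) : 0 < u < v ->
  (\int[mu]_(x in `[u, v]) (gamma_majorant a x)%:E <= 1%:E)%E.
Proof.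
move=> /andP[u0 uv].
have pos x : u <= x -> 0 < x by exact: lt_le_trans.
rewrite (@continuous_FTC2 _ (gamma_majorant a) (gamma_primitive a))//; last 1 first.
- move=> x; rewrite in_itv/= => /andP[/ltW/pos x0 _]; rewrite derive1E.
  by have [_ ->] := is_derive_gamma_primitive a x0.
- rewrite -EFinB lee_fin /gamma_primitive opprK.
  have p1 y : 1 <= 1 + y `^ a by rewrite lerDl powR_ge0.
  have : (1 + u `^ a)^-1 <= 1 by rewrite invf_le1// (lt_le_trans _ (p1 _)).
  have : 0 <= (1 + v `^ a)^-1 by rewrite invr_ge0 (le_trans _ (p1 _)).
  lra.
- apply/continuous_within_itvP => //; split.
  + move=> x; rewrite in_itv/= => /andP[/ltW/pos x0 _].
    exact: continuous_gamma_majorant.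
  + by apply: cvg_at_right_filter; apply: continuous_gamma_majorant.
  + by apply: cvg_at_left_filter; apply: continuous_gamma_majorant; rewrite pos// ltW.
have cG x : u <= x -> {for x, continuous (gamma_primitive a)}.
  move=> /pos x0; apply/differentiable_continuous/derivable1_diffP.
  by have [] := is_derive_gamma_primitive a x0.
split.
- move=> x; rewrite in_itv/= => /andP[/ltW/pos x0 _].
  by have [] := is_derive_gamma_primitive a x0.
- by apply: cvg_at_right_filter; apply: cG.
- by apply: cvg_at_left_filter; apply: cG; rewrite ltW.
Qed.

Definition gamma_integrand (a x : R) : R := x `^ (a - 1) * expR (- x).

Lemma measurable_gamma_integrand a : measurable_fun [set: R] (gamma_integrand a).
Proof.
apply: measurable_funM; first exact: measurable_funTS (measurable_powR _).
by apply: measurableT_comp => //; exact: measurable_funN.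
Qed.

Lemma gamma_integrand_ge0 a x : 0 <= gamma_integrand a x.
Proof. by rewrite mulr_ge0 ?powR_ge0 ?expR_ge0. Qed.

Definition gamma_const (a : R) : R := (1 + (2 * a) `^ a) ^+ 2 / a.

Lemma gamma_integrand_le_majorant (a x : R) : 0 < a -> 0 < x ->
  gamma_integrand a x <= gamma_const a * gamma_majorant a x.
Proof.
move=> a0 x0.
have -> : gamma_const a * gamma_majorant a x =
    x `^ (a - 1) * ((1 + (2 * a) `^ a) ^+ 2 / (1 + x `^ a) ^+ 2).
  rewrite /gamma_const /gamma_majorant; field.
  by rewrite (gt_eqF a0) gt_eqF ?ltr_pwDl ?powR_ge0.
rewrite /gamma_integrand ler_wpM2l ?powR_ge0// ler_pdivlMr; last first.
  by rewrite exprn_gt0// ltr_pwDl// powR_ge0.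
rewrite expRN mulrC ler_pdivrMr ?expR_gt0//.
have -> : expR x = expR (x / 2) ^+ 2 by rewrite -expRM_natl; congr expR; field.
rewrite -exprMn lerXn2r// ?nnegrE ?addr_ge0 ?mulr_ge0 ?expR_ge0 ?addr_ge0 ?powR_ge0//.
rewrite mulrDl mul1r lerD ?powR_le_expR_half//.
by rewrite -expR0 ler_expR divr_ge0// ltW.
Qed.

(** The real-valued integral is 0 by convention when the integral is infinite, so
    that finiteness is the point. On compact subintervals the majorant is
    integrated by the fundamental theorem of calculus; these subintervals then
    exhaust the half-line. *)
Lemma integral_gamma_integrand_le (a : R) : 0 < a ->
  (\int[mu]_(x in `]0%R, +oo[) (gamma_integrand a x)%:E <= (gamma_const a)%:E)%E.
Proof.
move=> a0; have C0 : 0 <= gamma_const a.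
  by rewrite divr_ge0 ?exprn_ge0 ?addr_ge0 ?powR_ge0// ltW.
pose I n : set R := `[n.+2%:R^-1, n.+2%:R].
have -> : `]0, +oo[%classic = \bigcup_n I n.
  apply/seteqP; split => x /=; rewrite in_itv/= ?andbT.
    move=> x0; exists (maxn (Num.trunc x) (Num.trunc x^-1)) => //=.
    rewrite /I/= in_itv/=; apply/andP; split.
      rewrite invf_ple ?posrE// ltW// (lt_le_trans (truncnS_gt _))// ler_nat.
      by rewrite ltnS leqW// leq_maxr.
    rewrite ltW// (lt_le_trans (truncnS_gt _))// ler_nat.
    by rewrite ltnS leqW// leq_maxl.
  by move=> [n _]; rewrite /I/= in_itv/= => /andP[+ _]; apply: lt_le_trans.
have mI n : measurable (I n) by exact: measurable_itv.
have mfI D : measurable_fun D (EFin \o gamma_integrand a).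
  apply/measurable_EFinP; exact: measurable_funTS (measurable_gamma_integrand _).
have cvI : (\int[mu]_(x in I n) (gamma_integrand a x)%:E)%E @[n --> \oo] -->
    (\int[mu]_(x in \bigcup_n I n) (gamma_integrand a x)%:E)%E.
  apply: ge0_nondecreasing_set_cvg_integral => //; last 2 first.
  - by move=> n; exact: mfI.
  - by move=> n x _; rewrite lee_fin gamma_integrand_ge0.
  move=> m n mn; rewrite subsetEset => x; rewrite /I/= !in_itv/= => /andP[h1 h2].
  rewrite (le_trans h2) ?ler_nat// (le_trans _ h1)// lef_pV2 ?posrE//.
  by rewrite ler_nat.
rewrite -(cvg_lim _ cvI)//; apply: lime_le; first exact: cvgP cvI.
near=> n.
have I0 x : I n x -> 0 < x by rewrite /I/= in_itv/= => /andP[+ _]; apply: lt_le_trans.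
have mg : measurable_fun (I n) (EFin \o gamma_majorant a).
  apply/measurable_EFinP; apply: subspace_continuous_measurable_fun.
    exact: mI.
  by apply: continuous_in_subspaceT => x; rewrite inE => /I0; exact: continuous_gamma_majorant.
apply: (@le_trans _ _
  (\int[mu]_(x in I n) ((gamma_const a)%:E * (gamma_majorant a x)%:E))%E).
  apply: ge0_le_integral => //.
  - exact: mI.
  - by move=> x _; rewrite lee_fin gamma_integrand_ge0.
  - exact: mfI.
  - by apply: measurable_funeM; exact: mg.
  - by move=> x /I0 x0; rewrite -EFinM lee_fin gamma_integrand_le_majorant.
rewrite ge0_integralZl//; last 2 first.
- exact: mI.
- move=> x /I0 x0.
  by rewrite lee_fin divr_ge0 ?exprn_ge0 ?addr_ge0 ?mulr_ge0 ?powR_ge0// ltW.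
rewrite -[leRHS]mule1; apply: lee_wpmul2l; first by rewrite lee_fin.
apply: integral_gamma_majorant_le1; rewrite invr_gt0 ltr0n/=.
by rewrite (@lt_trans _ _ 1)// ?invf_lt1// ?ltr1n.
Unshelve. all: by end_near. Qed.

Lemma Gamma_gt0 (a : R) : 0 < a -> 0 < Gamma a.
Proof.
move=> a0; rewrite /Gamma /Rintegral fine_gt0//; apply/andP; split; last first.
  by apply: le_lt_trans (integral_gamma_integrand_le a0) _; rewrite ltry.
have mf D : measurable_fun D (EFin \o gamma_integrand a).
  apply/measurable_EFinP; exact: measurable_funTS (measurable_gamma_integrand _).
apply: (@lt_le_trans _ _ (\int[mu]_(x in `[1%R, 2%R]) (gamma_integrand a x)%:E)%E); last first.
  apply: ge0_subset_integral => //; first exact: mf.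
    by move=> x _; rewrite lee_fin gamma_integrand_ge0.
  move=> x /=; rewrite !in_itv/= andbT => /andP[+ _]; exact: lt_le_trans.
apply: (@lt_le_trans _ _ (\int[mu]_(x in `[1%R, 2%R]) (cst (2^-1 * expR (-2))%:E x))%E).
  rewrite integral_cst//= lebesgue_measure_itv/= lte_fin ltr1n -EFinB -EFinM lte_fin.
  by rewrite mulr_gt0 ?mulr_gt0 ?expR_gt0// subr_gt0 ltr1n.
apply: ge0_le_integral => //.
- by move=> x _; rewrite lee_fin mulr_ge0// expR_ge0.
- exact: mf.
move=> x /=; rewrite in_itv/= => /andP[x1 x2]; rewrite lee_fin.
rewrite ler_pM ?expR_ge0// ?ler_expR ?lerN2//.
(* On the segment from 1 to 2 the power is at least x^-1 >= 1 / 2. *)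
apply: (@le_trans _ _ (x `^ (-1))).
  by rewrite powR_inv1 ?(le_trans _ x1)// lef_pV2 ?posrE// (lt_le_trans _ x1).
by apply: ler_powR => //; rewrite lerBrDr addNr ltW.
Qed.
End GammaPositive.

(** * Positive definite matrices and rank one updates *)

(** The matrix of size 1 + n with blocks 1, - y^T, x and 1 is the product of an
    upper and a lower triangular block matrix in both orders; comparing the two
    determinants gives the identity. *)
Lemma det_mx1_rank1 (R : comNzRingType) n (x y : 'cV[R]_n) :
  \det (1%:M + x *m y^T) = 1 + (y^T *m x) ord0 ord0.
Proof.
pose L : 'M[R]_(1 + n) := block_mx 1%:M 0 x 1%:M.
have dL : \det L = 1 by rewrite det_lblock !det1 mulr1.
have e : L *m block_mx 1%:M (- y^T) 0 (1%:M + x *m y^T) =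
         block_mx (1%:M + y^T *m x) (- y^T) 0 1%:M *m L.
  rewrite !mulmx_block !mul1mx !mul0mx !mulmx1 !mulmx0 !addr0 !add0r mulmxN.
  by rewrite mulNmx addrK addrCA addNr addr0.
have := congr1 (fun M => \det M) e.
rewrite !det_mulmx dL mul1r mulr1 !det_ublock !det1 mul1r mulr1 => ->.
by rewrite det_mx11 !mxE eqxx.
Qed.

Lemma det_add_rank1 (R : comUnitRingType) n (A : 'M[R]_n) (x y : 'cV[R]_n) : A \in unitmx ->
  \det (A + x *m y^T) = \det A * (1 + (y^T *m invmx A *m x) ord0 ord0).
Proof.
move=> uA; rewrite -mulmxA -det_mx1_rank1 -det_mulmx mulmxDr mulmx1.
by rewrite mulmxA mulmxA mulmxV// mul1mx.
Qed.

Section PositiveDefinite.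
Variable R : realType.

Lemma posdefmx_unit n (A : 'M[R]_n) : posdefmx A -> A \in unitmx.
Proof.
move=> [_ Apos]; rewrite unitmxE unitfE; apply/negP => /det0P[v v0 vA].
have := Apos v^T; rewrite trmxK vA mul0mx mxE ltxx => h.
by have : false by apply: h; rewrite -[X in _ != X]trmx0 (inj_eq trmx_inj).
Qed.

Lemma posdefmx_convex n (A : 'M[R]_n) (s : R) : posdefmx A -> 0 <= s <= 1 ->
  posdefmx ((1 - s)%:M + s *: A).
Proof.
move=> [As Apos] /andP[s0 s1]; split.
  by rewrite linearD /= linearZ /= tr_scalar_mx As.
move=> x x0; rewrite mulmxDr mulmxDl -scalemxAr -scalemxAl mxE.
rewrite [X in _ < _ + X]mxE mul_mx_scalar -scalemxAl [X in _ < X + _]mxE.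
have xx : 0 < (x^T *m x) ord0 ord0.
  have /cV0Pn[k xk] := x0.
  rewrite mxE (bigD1 k)//= ltr_pwDl//.
    by rewrite mxE -expr2 exprn_even_gt0.
  by apply: sumr_ge0 => l _; rewrite mxE -expr2 sqr_ge0.
have := Apos x x0.
(* The first summand vanishes at s = 1, the second at s = 0. *)
have [->|sn] := eqVneq s 0; first by rewrite mul0r addr0 subr0 mul1r.
move=> Ax; rewrite ltr_wpDl ?mulr_ge0 ?subr_ge0//; first exact: ltW.
by rewrite mulr_gt0// lt0r sn.
Qed.

(** The determinant has no zero on the segment from the identity to A, so by the
    intermediate value theorem for polynomials it keeps the sign that it has at
    the identity. *)
Lemma posdefmx_det_gt0 n (A : 'M[R]_n) : posdefmx A -> 0 < \det A.
Proof.
move=> Ap; rewrite ltNge; apply/negP => dA.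
pose p : {poly R} := \det ((1 - 'X)%:M + 'X *: map_mx polyC A).
have pE s : p.[s] = \det ((1 - s)%:M + s *: A).
  rewrite -horner_evalE /p -det_map_mx; congr (\det _).
  rewrite map_mxD map_scalar_mx map_mxZ -map_mx_comp /= !horner_evalE !hornerE.
  by congr (_ + _ *: _); apply/matrixP => i j; rewrite !mxE/= horner_evalE hornerC.
have [|s s01] := @poly_ivt _ (- p) 0 1 ler01.
  rewrite !hornerN !pE subr0 subrr scale0r addr0 det1 raddf0 add0r scale1r.
  by rewrite oppr_ge0 dA oppr_le0 ler01.
rewrite rootN => /rootP; rewrite pE => /eqP; apply/negP.
have /posdefmx_unit := posdefmx_convex Ap s01.
by rewrite unitmxE unitfE.
Qed.

Definition psdmx n (V : 'M[R]_n) : Prop :=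
  V^T = V /\ forall x : 'cV[R]_n, 0 <= (x^T *m V *m x) ord0 ord0.

Lemma psdmx0 n : psdmx (0 : 'M[R]_n).
Proof. by split=> [|x]; rewrite ?trmx0// mulmx0 mul0mx mxE. Qed.

Lemma psdmxD n (U V : 'M[R]_n) : psdmx U -> psdmx V -> psdmx (U + V).
Proof.
move=> [Us Up] [Vs Vp]; split=> [|x]; first by rewrite linearD/= Us Vs.
by rewrite mulmxDr mulmxDl mxE addr_ge0.
Qed.

Lemma psdmx_rank1 n (a : R) (v : 'cV[R]_n) : 0 <= a -> psdmx (a *: (v *m v^T)).
Proof.
move=> a0; split=> [|x]; first by rewrite linearZ/= trmx_mul trmxK.
rewrite -scalemxAr -scalemxAl mxE mulr_ge0// mulmxA -(mulmxA (_ *m _)).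
have -> : v^T *m x = (x^T *m v)^T by rewrite trmx_mul trmxK.
by rewrite mxE big_ord1 [X in _ * X]mxE -expr2 sqr_ge0.
Qed.

Lemma psdmx_scatter n (I : finType) (A : {set I}) (y : I -> 'cV[R]_n) :
  psdmx (scatter A y).
Proof.
rewrite /scatter; elim/big_ind: _ => [|U V|k _].
- exact: psdmx0.
- exact: psdmxD.
- by rewrite -[_ *m _]scale1r; apply: psdmx_rank1.
Qed.

Lemma posdefmxDpsd n (A V : 'M[R]_n) : posdefmx A -> psdmx V -> posdefmx (A + V).
Proof.
move=> [As Ap] [Vs Vp]; split=> [|x x0]; first by rewrite linearD/= As Vs.
by rewrite mulmxDr mulmxDl mxE ltr_pwDl// Ap.
Qed.

Lemma posdefmx_inv n (A : 'M[R]_n) : posdefmx A -> posdefmx (invmx A).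
Proof.
move=> Apd; have uA := posdefmx_unit Apd; have [As Ap] := Apd; split=> [|x x0].
  by rewrite trmx_inv As.
have -> : x^T *m invmx A *m x = (invmx A *m x)^T *m A *m (invmx A *m x).
  by rewrite trmx_mul trmx_inv As -!mulmxA (mulmxA A) mulmxV// mul1mx.
apply: Ap; apply: contra_neq x0 => h.
by rewrite -(mul1mx x) -(mulmxV uA) -mulmxA h mulmx0.
Qed.

(** By the rank one update formula the determinant is a quadratic polynomial in
    t, with leading coefficient c det A (m^T A^-1 m). *)
Lemma det_add_rank1_asymptotics n (A : 'M[R]_n) (c : R) (y m : 'cV[R]_n) :
  posdefmx A -> 0 < c -> m != 0 ->
  exists2 L : R, 0 < L &
    \det (A + c *: ((y - t *: m) *m (y - t *: m)^T)) / t ^+ 2 @[t --> +oo] --> L.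
Proof.
move=> Apd c0 m0; have uA := posdefmx_unit Apd.
pose q (u v : 'cV[R]_n) := (u^T *m invmx A *m v) ord0 ord0.
exists (\det A * (c * q m m)).
  by rewrite !mulr_gt0 ?posdefmx_det_gt0//; apply: (posdefmx_inv Apd).2.
have e : \forall t \near +oo, \det A * (t^-1 * t^-1 + c * (q y y * (t^-1 * t^-1) -
    t^-1 * (q y m + q m y) + q m m)) =
    \det (A + c *: ((y - t *: m) *m (y - t *: m)^T)) / t ^+ 2.
  near=> t.
  have t0 : t != 0 by rewrite gt_eqF.
  rewrite scalemxAl det_add_rank1// -scalemxAr mxE -/(q _ _).
  have -> : q (y - t *: m) (y - t *: m) =
      q y y - t * (q y m + q m y) + t ^+ 2 * q m m.
    have tr : (y - t *: m)^T = y^T - t *: m^T by rewrite linearB linearZ.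
    rewrite /q tr mulmxBr !mulmxBl -!scalemxAr -!scalemxAl.
    by rewrite !(mxE, scalerA); ring.
  by field.
apply: cvg_trans; first exact: (near_eq_cvg e).
have V0 : t^-1 @[t --> +oo] --> (0 : R).
  apply/gtr0_cvgV0; last exact: cvg_id.
  exact: nbhs_pinfty_gt.
have -> : \det A * (c * q m m) =
    \det A * (0 * 0 + c * (q y y * (0 * 0) - 0 * (q y m + q m y) + q m m)) by ring.
apply: cvgM; first exact: cvg_cst.
apply: cvgD; first exact: cvgM.
apply: cvgM; first exact: cvg_cst.
apply: cvgD; last exact: cvg_cst.
apply: cvgB; last by apply: cvgM => //; exact: cvg_cst.
by apply: cvgM; [exact: cvg_cst|exact: cvgM].
Unshelve. all: by end_near. Qed.

End PositiveDefinite.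

Definition const_alloc (B K : nat) (k : 'I_K) : alloc B K := [ffun=> k].

(** * Asymptotics of the weights *)

Section WeightAsymptotics.
Variables (R : realType) (D N B K : nat).
Variables (Y : 'I_N -> 'cV[R]_D) (b : 'I_B -> 'I_N) (C : 'I_N -> 'I_K).
Variables (Sigma0 : 'M[R]_D) (beta nu0 : R).
Hypotheses (Sigma0_posdef : posdefmx Sigma0) (beta_gt0 : 0 < beta)
  (nu0_gt0 : 0 < nu0).
Hypothesis Gamma_arg_gt0 : forall (c : alloc B K) (k : 'I_K) (r : nat),
  (1 <= r <= D)%N -> 0 < nu0 + (n_unblocked b C k + n_blocked c k)%:R + 1 - r%:R.
Hypothesis n_unblocked_gt0 : forall k, (0 < n_unblocked b C k)%N.

Local Notation nub := (n_unblocked b C).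
Local Notation S := (S_full Y b C Sigma0).
Local Notation w := (weight Y b C Sigma0 beta nu0).

Lemma S_unblocked_posdef k : posdefmx (S_unblocked Y b C Sigma0 k).
Proof. by apply: posdefmxDpsd => //; exact: psdmx_scatter. Qed.

Lemma S_full_posdef (d : 'I_K -> R) (c : alloc B K) k : posdefmx (S d c k).
Proof.
rewrite /S_full; case: ifP => _; first exact: S_unblocked_posdef.
apply: posdefmxDpsd; last first.
  by apply: psdmx_rank1; rewrite divr_ge0.
apply: posdefmxDpsd; [exact: S_unblocked_posdef|exact: psdmx_scatter].
Qed.

Definition gamma_factor (c : alloc B K) (k : 'I_K) : R :=
  let m := (nub k + n_blocked c k)%N in
  Gamma (beta + m%:R) * \prod_(1 <= r < D.+1) Gamma (nu0 + m%:R + 1 - r%:R).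

Definition weight_factor (d : 'I_K -> R) (c : alloc B K) (k : 'I_K) : R :=
  let m := (nub k + n_blocked c k)%N in
  gamma_factor c k / ((\det (S d c k)) `^ ((nu0 + m%:R) / 2) * m%:R `^ (D%:R / 2)).

Lemma gamma_factor_gt0 c k : 0 < gamma_factor c k.
Proof.
rewrite mulr_gt0 ?Gamma_gt0 ?ltr_pwDl// big_seq_cond.
apply: prodr_gt0 => r; rewrite mem_index_iota ltnS andbT => rD.
exact/Gamma_gt0/Gamma_arg_gt0.
Qed.

Lemma weight_factor_gt0 d c k : 0 < weight_factor d c k.
Proof.
rewrite divr_gt0 ?gamma_factor_gt0// mulr_gt0// powR_gt0//.
  exact/posdefmx_det_gt0/S_full_posdef.
by rewrite ltr0n addn_gt0 n_unblocked_gt0.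
Qed.

Lemma weight_gt0 d c : 0 < w d c.
Proof. by apply: prodr_gt0 => k _; exact: weight_factor_gt0. Qed.

(** The rate at which the product of the determinant factors of [w d c] diverges.
    The first product collects the powers coming from the fixed observations of
    the occupied components, the second one those coming from the block. *)
Definition growth (d : 'I_K -> R) (c : alloc B K) : R :=
  (\prod_(k in codom c) d k `^ (nu0 + (nub k)%:R)) * \prod_s d (c s).

Definition growth_factor (d : 'I_K -> R) (c : alloc B K) (k : 'I_K) : R :=
  if n_blocked c k == 0%N then 1 else d k `^ (nu0 + (nub k + n_blocked c k)%:R).

Lemma growthE (d : 'I_K -> R) c : (forall k, 0 < d k) ->
  growth d c = \prod_k growth_factor d c k.
Proof.
move=> d0; rewrite /growth.
rewrite (partition_big c xpredT)//= big_mkcond /= -big_split/=.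
apply: eq_bigr => k _.
have -> : \prod_(s | c s == k) d (c s) = d k ^+ n_blocked c k.
  rewrite (eq_bigr (fun=> d k)); last by move=> s /eqP ->.
  by rewrite prodr_const /n_blocked /blocked cardsE.
have -> : (k \in codom c) = (n_blocked c k != 0%N).
  rewrite -lt0n card_gt0; apply/codomP/set0Pn => [[s ->]|[s]].
    by exists s; rewrite inE.
  by rewrite inE => /eqP <-; exists s.
rewrite /growth_factor; case: eqP => [->|_] /=; first by rewrite expr0 mulr1.
rewrite natrD addrA [RHS]powRD; last by rewrite (gt_eqF (d0 k)) implybT.
by rewrite [X in _ = _ * X]powR_mulrn// ltW.
Qed.

Variables (T : Type) (F : set_system T) (FF : ProperFilter F) (d : T -> 'I_K -> R).
Hypotheses (d_gt0 : forall t k, 0 < d t k)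
  (d_infty : forall k, d t k @[t --> F] --> +oo)
  (Ybar_neq0 : forall k, Ybar_unblocked Y b C k != 0).

(** An occupied component has a determinant of order (d k)^2, raised to half the
    exponent in the growth; an empty one does not depend on d. *)
Lemma weight_factor_asymptotics c k :
  exists2 L : R, 0 < L &
    weight_factor (d t) c k * growth_factor (d t) c k @[t --> F] --> L.
Proof.
rewrite /weight_factor /growth_factor; set m := (_ + _)%N.
have m0 : 0 < (m%:R : R) by rewrite ltr0n addn_gt0 n_unblocked_gt0.
have [q0|q0] := eqVneq (n_blocked c k) 0%N.
  exists (weight_factor (fun=> 1) c k); first exact: weight_factor_gt0.
  rewrite /weight_factor -/m /S_full q0 /=.
  under eq_fun do rewrite mulr1.
  exact: cvg_cst.
have Apd : posdefmx (S_unblocked Y b C Sigma0 k + scatter (blocked c k) (Y \o b)).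
  by apply: posdefmxDpsd; [exact: S_unblocked_posdef|exact: psdmx_scatter].
have c0 : 0 < ((n_blocked c k)%:R * (nub k)%:R / (nub k + n_blocked c k)%:R : R).
  by rewrite divr_gt0// mulr_gt0 ?ltr0n// lt0n.
have [L L0 HL] := det_add_rank1_asymptotics (Ybar_blocked Y b c k) Apd c0 (Ybar_neq0 k).
have {}HL := cvg_comp _ _ (d_infty k) HL.
pose e := (nu0 + m%:R) / 2.
exists (gamma_factor c k / (L `^ e * m%:R `^ (D%:R / 2))).
  by rewrite divr_gt0 ?gamma_factor_gt0// mulr_gt0 ?powR_gt0.
pose h t := \det (S (d t) c k) / d t k ^+ 2.
have hL : h t @[t --> F] --> L.
  move: HL; apply: cvg_trans; apply: near_eq_cvg; near=> t.
  by rewrite /h /S_full (negbTE q0).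
have E t : gamma_factor c k / (h t `^ e * m%:R `^ (D%:R / 2)) =
   gamma_factor c k / (\det (S (d t) c k) `^ e * m%:R `^ (D%:R / 2)) *
     d t k `^ (nu0 + m%:R).
  have dp := d_gt0 t k; have Sp := posdefmx_det_gt0 (S_full_posdef (d t) c k).
  have -> : d t k `^ (nu0 + m%:R) = (d t k ^+ 2) `^ e.
    by rewrite -powR_mulrn ?ltW// -powRrM /e; congr powR; field.
  have -> : \det (S (d t) c k) = h t * d t k ^+ 2.
    by rewrite /h divfK// expf_neq0// gt_eqF.
  have hp : 0 < h t by rewrite divr_gt0// exprn_gt0.
  have d2 : 0 < d t k ^+ 2 by rewrite exprn_gt0.
  rewrite (powRM _ (ltW hp) (ltW d2)).
  have := powR_gt0 e hp; have := powR_gt0 e d2; have := powR_gt0 (D%:R / 2) m0.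
  move: (_ `^ _) (_ `^ _) (_ `^ _) => x y z x0 y0 z0.
  by field; rewrite !gt_eqF.
rewrite -(eq_cvg _ _ E).
apply: cvgM; first exact: cvg_cst.
apply: cvgV; first by rewrite mulf_neq0// gt_eqF// powR_gt0.
apply: cvgM; last exact: cvg_cst.
have ce : {for L, continuous (fun x : R => x `^ e)}.
  apply/differentiable_continuous/derivable1_diffP.
  by have [] := is_derive1_powR e L0.
exact: cvg_comp _ _ hL ce.
Unshelve. all: by end_near. Qed.

Lemma weight_asymptotics c :
  exists2 L : R, 0 < L & w (d t) c * growth (d t) c @[t --> F] --> L.
Proof.
have [L HL] := choice (fun k => let: ex_intro2 L L0 cL := weight_factor_asymptotics c k
  in ex_intro _ L (conj L0 cL)).
exists (\prod_k L k); first by apply: prodr_gt0 => k _; exact: (HL k).1.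
under eq_fun do rewrite growthE// /weight -big_split/=.
by apply: cvg_big => [|k _]; [exact: mul_continuous|exact: (HL k).2].
Qed.

Hypothesis d_comparable : forall l m, exists M : R, \forall t \near F, d t l <= M * d t m.

(** Merging the whole block into one of the occupied components k changes the
    second product of the growth by a bounded factor only, since the scales are
    comparable, and removes from the first one all factors except that of k; at
    least one diverging factor disappears. *)
Lemma growth_ratio_to0 (c : alloc B K) k : k \in codom c -> c != const_alloc B k ->
  growth (d t) (const_alloc B k) / growth (d t) c @[t --> F] --> (0 : R).
Proof.
move=> kc cneq.
have [s0 s0k] : exists s0, c s0 != k.
  apply/existsP; rewrite -negb_forall; apply: contra cneq => /forallP h.
  by apply/eqP/ffunP => s; rewrite ffunE; exact/eqP/h.
set m := c s0 in s0k.
have mc : m \in codom c by exact: codom_f.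
have [M HM] := choice (fun s : 'I_B => d_comparable k (c s)).
have growth0 t c' : 0 < growth (d t) c'.
  by rewrite mulr_gt0// prodr_gt0// => *; rewrite powR_gt0.
apply: (@squeeze_cvgr _ _ _ _ (fun=> 0) (fun t => (\prod_s M s) * (d t m)^-1)).
- have M1 : \forall t \near F, forall s, d t k <= M s * d t (c s).
    exact: filter_forall.
  have d1 : \forall t \near F, forall l, 1 <= d t l.
    by apply: filter_forall => l; have /cvgryPge := d_infty l; exact.
  near=> t.
  have M1t : forall s, d t k <= M s * d t (c s) by near: t.
  have d1t l : 1 <= d t l by move: l; near: t.
  apply/andP; split; first by rewrite divr_ge0 ?ltW.
  rewrite ler_pdivrMr// /growth.
  have -> : \prod_(l in codom (const_alloc B k)) d t l `^ (nu0 + (nub l)%:R) =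
            d t k `^ (nu0 + (nub k)%:R).
    rewrite (big_pred1 k)// => l; apply/codomP/eqP => [[s ->]|->]; first by rewrite ffunE.
    by exists s0; rewrite ffunE.
  under [X in _ * X <= _]eq_bigr do rewrite ffunE.
  rewrite (bigD1 k)//= (bigD1 m)/=; last by rewrite mc.
  set e := fun l => nu0 + (nub l)%:R.
  have e1 l : 1 <= e l by rewrite /e ler_wpDl ?(ltW nu0_gt0)// ler1n.
  set P := \prod_(l | (l \in codom c) && (l != k) && (l != m)) _.
  have P1 : 1 <= P.
    rewrite /P; elim/big_ind: _ => // [x y x1 y1|l _].
      by rewrite -[1]mulr1 ler_pM.
    exact: le_trans (d1t l) (le1r_powR (d1t l) (e1 l)).
  (* The exponent is at least n_unblocked m, hence at least 1. *)
  have dm : d t m <= d t m `^ e m by rewrite le1r_powR.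
  have Q : \prod_(s < B) d t k <= (\prod_s M s) * \prod_s d t (c s).
    by rewrite -big_split/=; apply: ler_prod => s _; rewrite ltW//=.
  have dk := powR_gt0 (e k) (d_gt0 t k).
  have dm0 := d_gt0 t m.
  have -> : (\prod_s M s) / d t m *
      (d t k `^ e k * (d t m `^ e m * P) * \prod_s d t (c s)) =
     d t k `^ e k * ((\prod_s M s * \prod_s d t (c s)) * ((d t m `^ e m / d t m) * P)).
    by rewrite /=; field; rewrite gt_eqF.
  apply: ler_wpM2l; first exact: ltW.
  apply: (le_trans Q).
  apply: ler_peMr; last by rewrite -[1]mulr1 ler_pM// ler_pdivlMr// mul1r.
  by apply: le_trans Q; apply: prodr_ge0 => *; rewrite ltW.
- exact: cvg_cst.
- rewrite -[X in _ --> X](mulr0 (\prod_s M s)).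
  apply: cvgM; first exact: cvg_cst.
  by apply/gtr0_cvgV0 => //; apply: nearW.
Unshelve. all: by end_near. Qed.

Lemma weight_ratio_to0 (c : alloc B K) k : k \in codom c -> c != const_alloc B k ->
  w (d t) c / w (d t) (const_alloc B k) @[t --> F] --> (0 : R).
Proof.
move=> kc cneq.
have [L L0 HL] := weight_asymptotics c.
have [L' L'0 HL'] := weight_asymptotics (const_alloc B k).
have growth0 t c' : 0 < growth (d t) c'.
  by rewrite mulr_gt0// prodr_gt0// => *; rewrite powR_gt0.
have -> : (0 : R) = L / L' * 0 by rewrite mulr0.
have E t : (w (d t) c * growth (d t) c) / (w (d t) (const_alloc B k) *
    growth (d t) (const_alloc B k)) * (growth (d t) (const_alloc B k) / growth (d t) c) =
    w (d t) c / w (d t) (const_alloc B k).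
  have := weight_gt0 (d t) (const_alloc B k).
  have := growth0 t c; have := growth0 t (const_alloc B k).
  move: (growth _ _) (growth _ _) (w _ _) (w _ _) => x y z u x0 y0 u0.
  by field; rewrite !gt_eqF.
rewrite -(eq_cvg _ _ E).
apply: cvgM; last exact: growth_ratio_to0.
by apply: cvgM => //; apply: cvgV => //; rewrite gt_eqF.
Qed.

End WeightAsymptotics.

(** * Eigenvalues of self-adjoint operators on a finite space *)

Section SelfAdjoint.
Variables (C : numClosedFieldType) (I : finType) (m : I -> C).
Hypothesis m_gt0 : forall c, 0 < m c.
Local Open Scope sesquilinear_scope.

Definition dot (f g : I -> C) : C := \sum_c m c * f c * (g c)^*.

(** In the orthonormal basis of normalized point masses the operator is a
    Hermitian matrix. In an orthonormal eigenbasis the Rayleigh quotient is an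
    average of the eigenvalues, so that its modulus is at most the largest
    modulus of an eigenvalue. *)
Lemma self_adjoint_eigenvalue (T : (I -> C) -> I -> C) (f : I -> C) :
  (forall a u v, T (fun c => a * u c + v c) = fun c => a * T u c + T v c) ->
  (forall u v, dot (T u) v = dot u (T v)) ->
  I ->
  exists lambda v, [/\ exists c, v c != 0, forall c, T v c = lambda * v c
    & `|dot (T f) f| <= `|lambda| * dot f f].
Proof.
move=> linT saT c0.
pose n := #|I|.
have sm c : sqrtC (m c) != 0 by rewrite sqrtC_eq0 gt_eqF.
have smJ c : (sqrtC (m c))^* = sqrtC (m c).
  by apply: conj_Creal; rewrite ger0_real// sqrtC_ge0 ltW.
have smm c : m c = sqrtC (m c) * sqrtC (m c) by rewrite -expr2 sqrtCK.
pose phi (v : 'rV[C]_n) c := v 0 (enum_rank c) / sqrtC (m c).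
pose psi (u : I -> C) : 'rV[C]_n := \row_j (u (enum_val j) * sqrtC (m (enum_val j))).
have psiK u : phi (psi u) = u.
  by apply/funext => c; rewrite /phi mxE enum_rankK mulfK.
have phiK v : psi (phi v) = v.
  by apply/rowP => j; rewrite mxE /phi enum_valK divfK.
have dotE u v : dot u v = (psi u *m (psi v)^t*) 0 0.
  rewrite /dot mxE (reindex (@enum_val I predT)); last first.
    by apply: onW_bij; exact: enum_val_bij.
  apply: eq_bigr => j _; rewrite !mxE rmorphM/= smJ [X in X * _ * _ = _]smm; ring.
have phi_lin a u v : phi (a *: u + v) = fun c => a * phi u c + phi v c.
  by apply/funext => c; rewrite /phi !mxE mulrDl mulrA.
have psi_lin a u v : psi (fun c => a * u c + v c) = a *: psi u + psi v.
  by apply/rowP => j; rewrite !mxE mulrDl mulrA.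
pose M : 'M[C]_n := \matrix_(j, l) psi (T (phi (delta_mx 0 j))) 0 l.
have T0 : T (fun=> 0) = fun=> 0.
  have := linT (-1) (fun=> 0) (fun=> 0); rewrite /= mulr0 addr0 => ->.
  by apply/funext => c; rewrite mulN1r addNr.
have psi0 : psi (fun=> 0) = 0 by apply/rowP => j; rewrite !mxE mul0r.
have phi0 : phi 0 = fun=> 0 by apply/funext => c; rewrite /phi mxE mul0r.
have TM v : psi (T (phi v)) = v *m M.
  rewrite [in LHS](row_sum_delta v) mulmx_sum_row.
  elim/big_rec2: _ => [|j y x _ IH]; first by rewrite phi0 T0 psi0.
  rewrite phi_lin linT psi_lin -IH; congr (_ *: _ + _).
  by apply/rowP => l; rewrite !mxE.
have dotC u v : dot u v = (dot v u)^*.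
  rewrite /dot rmorph_sum/=; apply: eq_bigr => c _.
  by rewrite !rmorphM/= conjCK (conj_Creal (gtr0_real (m_gt0 c))) mulrAC.
(* The entries of M are the inner products of T e_j with e_l. *)
have Mherm : M^t* = M.
  have ME j l : M j l = dot (T (phi (delta_mx 0 j))) (phi (delta_mx 0 l)).
    rewrite dotE phiK [RHS]mxE (bigD1 l)//= big1 ?addr0 => [|k kl].
      by rewrite !mxE !eqxx/= conjC1 mulr1.
    by rewrite !mxE eqxx/= (negbTE kl) conjC0 mulr0.
  apply/matrixP => j l; rewrite !ME [LHS]mxE [X in X^*]mxE ME.
  by rewrite -dotC saT.
have /orthomx_spectralP : M \is normalmx by apply/normalmxP; rewrite Mherm.
set U := spectralmx M; set X := spectral_diag M => ME.
have Uu : U \is unitarymx by exact: spectral_unitarymx.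
have Uunit : U \in unitmx by exact: spectral_unit.
pose x := psi f *m U^t*.
have dotff : dot f f = \sum_i `|x 0 i| ^+ 2.
  have -> : dot f f = (x *m x^t*) 0 0.
    by rewrite dotE /x trmx_mul map_mxM trmxCK !mulmxA mulmxKtV.
  by rewrite mxE; apply: eq_bigr => i _; rewrite !mxE normCK.
have dotTf : dot (T f) f = \sum_i X 0 i * `|x 0 i| ^+ 2.
  have -> : dot (T f) f = (x *m diag_mx X *m x^t*) 0 0.
    rewrite dotE -[in T f](psiK f) TM ME invmx_unitary//.
    by rewrite /x trmx_mul map_mxM trmxCK !mulmxA.
  rewrite mul_mx_diag mxE; apply: eq_bigr => i _.
  by rewrite !mxE normCK mulrAC [in LHS]mulrC mulrCA mulrA.
pose i0 : 'I_n := enum_rank c0.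
have [i _ imax] := @real_arg_maxP C 'I_n i0 xpredT (fun i => `|X 0 i|) isT
  (fun _ _ => normr_real _).
exists (X 0 i), (phi (row i U)); split.
- have rU : row i U != 0.
    apply/negP => /eqP rU; have := congr1 (row i) (mulmxV Uunit).
    rewrite row_mul rU mul0mx row1 => /rowP/(_ i).
    by rewrite !mxE !eqxx => /eqP; rewrite eq_sym oner_eq0.
  have /rV0Pn[j Uj] := rU; exists (enum_val j).
  by rewrite /phi enum_valK mulf_neq0// invr_eq0.
- move=> c; rewrite -[T _]psiK TM ME !mulmxA -row_mul mulmxV//.
  rewrite row1 -rowE row_diag_mx -scalemxAl -rowE.
  by rewrite /phi mxE mulrA.
- rewrite dotTf dotff mulr_sumr; apply: le_trans (ler_norm_sum _ _ _) _.
  apply: ler_sum => j _; rewrite normrM normrX normr_id.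
  by apply: ler_wpM2r; [rewrite exprn_ge0|exact: imax].
Qed.
End SelfAdjoint.

(** * Spectrum of the Gibbs sampler *)

Section GibbsSpectrum.
Local Open Scope complex_scope.
Variables (R : realType) (B K : nat) (pi : alloc B K -> R).
Hypotheses (pi_gt0 : forall c, 0 < pi c) (pi_sum1 : \sum_c pi c = 1).

Local Notation fc := (full_conditional pi).
Local Notation rs := (resample pi).
Local Notation inner := (dot (fun c => (pi c)%:C)).

Lemma realC_sum (I : Type) (r : seq I) (P : pred I) (F : I -> R) :
  (\sum_(x <- r | P x) F x)%:C = \sum_(x <- r | P x) (F x)%:C.
Proof. exact: (raddf_sum (real_complex R)). Qed.

Lemma realCM (x y : R) : (x * y)%:C = x%:C * y%:C.
Proof. exact: (rmorphM (real_complex R)). Qed.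

Lemma realC_conj (x : R) : (x%:C)^*%R = x%:C.
Proof. by rewrite conj_Creal// complex_real. Qed.

Lemma norm_normc (z : R[i]) : `|z| = (normc z)%:C.
Proof. by case: z. Qed.

Lemma updateK s (c : alloc B K) k : update (update c s k) s (c s) = c.
Proof. by apply/ffunP => r; rewrite !ffunE; case: eqP => [->|]. Qed.

Lemma update_update s (c : alloc B K) k k0 : update (update c s k) s k0 = update c s k0.
Proof. by apply/ffunP => r; rewrite !ffunE; case: eqP. Qed.

Lemma update_same s (c : alloc B K) k : update c s k s = k.
Proof. by rewrite ffunE eqxx. Qed.

(** The map (c, k) to (update c s k, c s) is an involution: it exchanges the state
    before and the state after a move at site s. *)
Lemma exchange_update (V : nmodType) s (G : alloc B K -> 'I_K -> V) :
  \sum_c \sum_k G c k = \sum_c \sum_k G (update c s k) (c s).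
Proof.
rewrite !pair_big /=.
pose h (p : alloc B K * 'I_K) := (update p.1 s p.2, p.1 s).
have hK : involutive h by case=> c k; rewrite /h/= updateK update_same.
by rewrite (reindex_inj (inv_inj hK)).
Qed.

Lemma fc_ge0 s c k : 0 <= fc s c k.
Proof.
by apply: divr_ge0; [exact: ltW|apply: sumr_ge0 => *; exact: ltW].
Qed.

Lemma sum_fc s c : \sum_k fc s c k = 1.
Proof.
rewrite -mulr_suml divff// gt_eqF// (bigD1 (c s))//= ltr_pwDl//.
by apply: sumr_ge0 => *; exact: ltW.
Qed.

Lemma detailed_balance s c k :
  pi (update c s k) * fc s (update c s k) (c s) = pi c * fc s c k.
Proof.
rewrite /full_conditional updateK.
under eq_bigr do rewrite update_update.
by rewrite !mulrA [pi _ * pi c]mulrC.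
Qed.

Lemma resample_self_adjoint s f g : inner (rs s f) g = inner f (rs s g).
Proof.
rewrite /dot /resample.
under eq_bigr do rewrite mulr_sumr mulr_suml.
under [RHS]eq_bigr do rewrite rmorph_sum mulr_sumr.
rewrite (exchange_update s); apply: eq_bigr => c _; apply: eq_bigr => k _ /=.
rewrite updateK [X in _ = _ * X]rmorphM/= realC_conj !mulrA -realCM.
by rewrite detailed_balance realCM; ring.
Qed.

Lemma resample_linear s a u v :
  rs s (fun c => a * u c + v c) = fun c => a * rs s u c + rs s v c.
Proof.
apply/funext => c; rewrite /resample mulr_sumr -big_split/=.
by apply: eq_bigr => k _; ring.
Qed.

Lemma resample_cst s (a : R[i]) : rs s (fun=> a) = fun=> a.
Proof.
apply/funext => c; rewrite /resample -mulr_suml -realC_sum sum_fc.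
exact: mul1r.
Qed.

Lemma sweep_linear ss a u v : sweep pi ss (fun c => a * u c + v c) =
  fun c => a * sweep pi ss u c + sweep pi ss v c.
Proof. by elim: ss => //= s ss ->; rewrite resample_linear. Qed.

Lemma sweep_cst ss (a : R[i]) : sweep pi ss (fun=> a) = fun=> a.
Proof. by elim: ss => //= s ss ->; rewrite resample_cst. Qed.

Lemma sweep_cat ss ss' f : sweep pi (ss ++ ss') f = sweep pi ss (sweep pi ss' f).
Proof. exact: foldr_cat. Qed.

Lemma sweep_adjoint ss f g : inner (sweep pi ss f) g = inner f (sweep pi (rev ss) g).
Proof.
elim: ss f g => // s ss IH f g /=.
by rewrite resample_self_adjoint IH rev_cons -cats1 sweep_cat.
Qed.

Lemma sweep_id ss f : {in ss, forall s, rs s f = f} -> sweep pi ss f = f.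
Proof.
elim: ss => //= s ss IH h; rewrite IH ?h ?mem_head// => s' s's.
by apply: h; rewrite in_cons s's orbT.
Qed.

Lemma resample_normc_le s f (M : R) : (forall c, normc (f c) <= M) ->
  forall c, normc (rs s f c) <= M.
Proof.
move=> fM c; rewrite -lecR -norm_normc /resample.
apply: le_trans (ler_norm_sum _ _ _) _.
apply: (@le_trans _ _ (\sum_k (fc s c k)%:C * M%:C)).
  apply: ler_sum => k _; rewrite normrM !norm_normc -!realCM lecR.
  rewrite [normc _%:C]/normc/= expr0n/= addr0 sqrtr_sqr ger0_norm ?fc_ge0//.
  by rewrite ler_wpM2l ?fc_ge0.
by rewrite -mulr_suml -realC_sum sum_fc mul1r.
Qed.

(** Maximum principle: resampling averages the values of a function. *)
Lemma gibbs_eigenvalue_le1 lambda : gibbs_eigenvalue pi lambda -> normc lambda <= 1.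
Proof.
move=> [f [_ [c0 fc0] fE]].
have [c _ cmax] := @arg_maxP _ _ _ c0 xpredT (fun c => normc (f c)) isT.
have bound ss : forall c', normc (sweep pi ss f c') <= normc (f c).
  by elim: ss => [|s ss IH] c' /=; [exact: cmax|exact: resample_normc_le].
have f0 : 0 < normc (f c).
  apply: lt_le_trans (cmax c0 isT).
  by have := fc0; rewrite -normr_gt0 norm_normc ltcR.
have := bound (enum 'I_B ++ rev (enum 'I_B)) c; rewrite -/(gibbs_operator pi f c).
by rewrite fE normcM -[leRHS]mul1r ler_pM2r.
Qed.

Lemma gibbs_eigenvalue_le_rate lambda :
  gibbs_eigenvalue pi lambda -> normc lambda <= gibbs_rate pi.
Proof.
move=> el; apply: ub_le_sup; last by exists lambda.
by exists 1 => _ [l el' ->]; exact: gibbs_eigenvalue_le1.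
Qed.

Lemma gibbs_rate_le1 : gibbs_rate pi <= 1.
Proof.
rewrite /gibbs_rate; set E := [set _ | _].
have [->|/set0P E0] := eqVneq E set0; first by rewrite sup0.
apply: ge_sup => // _ [l el ->]; exact: gibbs_eigenvalue_le1.
Qed.

Lemma inner_cstE (a : R[i]) : inner (fun=> a) (fun=> a) = `|a| ^+ 2.
Proof.
rewrite /dot; under eq_bigr do rewrite -mulrA -normCK.
by rewrite -mulr_suml -realC_sum pi_sum1 mul1r.
Qed.

Lemma innerDl a u v f : inner (fun c => a * u c + v c) f = a * inner u f + inner v f.
Proof.
rewrite /dot mulr_sumr -big_split/=; apply: eq_bigr => c _; ring.
Qed.

Lemma innerC u v : inner u v = (inner v u)^*%R.
Proof.
rewrite /dot rmorph_sum/=; apply: eq_bigr => c _.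
rewrite [X in _ = X]rmorphM/= [X in _ = X * _]rmorphM/= conjCK realC_conj; ring.
Qed.

Lemma innerDr a u v f : inner f (fun c => a * u c + v c) =
  a^*%R * inner f u + inner f v.
Proof. by rewrite innerC innerDl rmorphD rmorphM/= -!innerC. Qed.

Lemma mean_zeroE f : mean_zero pi f <-> inner f (fun=> 1) = 0.
Proof.
by rewrite /mean_zero /dot; under [X in _ <-> X = _]eq_bigr do rewrite conjC1 mulr1.
Qed.

Lemma gibbs_adjoint f g :
  inner (gibbs_operator pi f) g = inner f (gibbs_operator pi g).
Proof. by rewrite sweep_adjoint rev_cat revK. Qed.

(** The operator T u = P u - E u is self-adjoint and kills the constants. An
    eigenfunction of T with a non-zero eigenvalue has mean zero, so that it is an
    eigenfunction of the Gibbs operator P counted in the rate. *)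
Lemma gibbs_rate_ge_rayleigh f (r : R) : mean_zero pi f -> 0 < r ->
  0 < inner f f -> r%:C * inner f f <= inner (gibbs_operator pi f) f ->
  r <= gibbs_rate pi.
Proof.
move=> f0 r0 ff0 rf.
pose T u : alloc B K -> R[i] := fun c => gibbs_operator pi u c - inner u (fun=> 1).
have piC c : 0 < (pi c)%:C by rewrite ltcR.
have TE u : T u = fun c => (- inner u (fun=> 1)) * 1 + gibbs_operator pi u c.
  by apply/funext => c; rewrite mulr1 addrC.
have T_lin a u v : T (fun c => a * u c + v c) = fun c => a * T u c + T v c.
  apply/funext => c; rewrite /T /gibbs_operator sweep_linear innerDl; ring.
have T_sa u v : inner (T u) v = inner u (T v).
  rewrite !TE innerDl innerDr gibbs_adjoint rmorphN/= -innerC.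
  by ring.
have [c0 _|I0] := pickP (xpredT : pred (alloc B K)); last first.
  by move: ff0; rewrite /dot big_pred0 ?ltxx.
have [l [v [v0 vE le]]] := self_adjoint_eigenvalue piC f T_lin T_sa c0.
have Tf : inner (T f) f = inner (gibbs_operator pi f) f.
  by rewrite TE innerDl (mean_zeroE f).1// oppr0 mul0r add0r.
have rl : r <= normc l.
  rewrite -lecR -norm_normc -(ler_pM2r ff0).
  have Pf0 := le_trans (ltW (mulr_gt0 (_ : 0 < r%:C) ff0)) rf.
  by apply: (le_trans rf); apply: le_trans le; rewrite Tf ger0_norm// Pf0// ltcR.
apply: (le_trans rl); apply: gibbs_eigenvalue_le_rate.
have l0 : l != 0.
  by rewrite -normr_gt0 norm_normc ltcR (lt_le_trans r0).
have v1 : inner v (fun=> 1) = 0.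
  have lv : inner (T v) (fun=> 1) = l * inner v (fun=> 1).
    rewrite /dot mulr_sumr; apply: eq_bigr => c _; rewrite vE; ring.
  have : inner (T v) (fun=> 1) = 0.
    rewrite TE innerDl inner_cstE normr1 expr1n mulr1 gibbs_adjoint.
    by rewrite /gibbs_operator sweep_cst addNr.
  by rewrite lv => /eqP; rewrite mulf_eq0 (negbTE l0) => /eqP.
exists v; split=> //; first exact/mean_zeroE.
by move=> c; rewrite -vE /T v1 subr0.
Qed.

Variables (i : 'I_B) (Q : pred 'I_K).

Definition site_mass : R := \sum_(c : alloc B K | Q (c i)) pi c.

Definition stay_mass : R :=
  \sum_(c : alloc B K | Q (c i)) pi c * \sum_(k | Q k) fc i c k.

(** Stationary flow out of the event Q (c i) during one resampling of site i. *)
Definition leave_mass : R :=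
  \sum_(c : alloc B K | Q (c i)) pi c * \sum_(k | ~~ Q k) fc i c k.

Lemma stay_leave : stay_mass = site_mass - leave_mass.
Proof.
apply/eqP; rewrite eq_sym subr_eq; apply/eqP; rewrite -big_split/=.
apply: eq_bigr => c _; rewrite -mulrDr -(bigID Q xpredT)/= sum_fc mulr1//.
Qed.

(** A move of site i out of the event does not touch site j, hence sites i and j
    disagree about Q either before or after the move. Moves of the first kind
    start in the first event on the right; by reversibility those of the second
    kind have the same mass as the reverse moves, which start in the second
    event. *)
Lemma leave_mass_le (j : 'I_B) : i != j ->
  leave_mass <= \sum_(c : alloc B K | Q (c i) && ~~ Q (c j)) pi c +
                \sum_(c : alloc B K | ~~ Q (c i) && Q (c j)) pi c.
Proof.
move=> ij; rewrite /leave_mass (bigID (fun c : alloc B K => Q (c j)))/= addrC lerD//.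
  apply: ler_sum => c _; rewrite ler_piMr ?(ltW (pi_gt0 _))// -(sum_fc i c).
  by rewrite [leRHS](bigID (fun k => ~~ Q k))/= lerDl sumr_ge0// => *; exact: fc_ge0.
have -> : \sum_(c : alloc B K | Q (c i) && Q (c j)) pi c * \sum_(k | ~~ Q k) fc i c k =
    \sum_(c : alloc B K) \sum_k
      (if [&& Q (c i), Q (c j) & ~~ Q k] then pi c * fc i c k else 0).
  rewrite big_mkcond; apply: eq_bigr => c _; case: ifP => [/andP[-> ->]|/negP h].
    by rewrite mulr_sumr big_mkcond.
  rewrite big1// => k _; case: ifP => // /and3P[h1 h2 _].
  by case: h; rewrite h1.
rewrite (exchange_update i) [leRHS]big_mkcond; apply: ler_sum => c _.
have -> : \sum_(k < K) (if [&& Q (update c i k i), Q (update c i k j) & ~~ Q (c i)]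
      then pi (update c i k) * fc i (update c i k) (c i) else 0) =
    \sum_(k < K) (if [&& Q k, Q (c j) & ~~ Q (c i)] then pi c * fc i c k else 0).
  apply: eq_bigr => k _.
  by rewrite update_same detailed_balance [update _ _ _ j]ffunE eq_sym (negbTE ij).
case: ifP => [/andP[-> ->]|/negP nh]; last first.
  rewrite big1// => k _; case: ifP => // /and3P[_ h1 h2].
  by case: nh; rewrite h1 h2.
rewrite -[leRHS]mulr1 -(sum_fc i c) mulr_sumr; apply: ler_sum => k _.
by case: ifP => // _; rewrite mulr_ge0 ?fc_ge0 ?ltW.
Qed.

Lemma resample_other s (g : 'I_K -> R[i]) : s != i ->
  rs s (fun c => g (c i)) = fun c => g (c i).
Proof.
move=> si; apply/funext => c; rewrite /resample.
under eq_bigr do rewrite ffunE eq_sym (negbTE si).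
by rewrite -mulr_suml -realC_sum sum_fc mul1r.
Qed.

(** Resampling any other site fixes a function of the coordinate i; the
    resamplings that follow that of i are moved to the right argument, which they
    fix as well. *)
Lemma inner_sweep_site (g : 'I_K -> R[i]) : let f := fun c : alloc B K => g (c i) in
  inner (sweep pi (rev (enum 'I_B)) f) f = inner (rs i f) f.
Proof.
move=> f; have := enum_uniq 'I_B; have : i \in enum 'I_B by rewrite mem_enum.
case/splitPr => s1 s2; rewrite cat_uniq/= => /and4P[_ /norP[is1 _] is2 _].
have fix_f ss : i \notin ss -> sweep pi ss f = f.
  move=> iss; apply: sweep_id => s ss_s; apply: resample_other.
  by apply: contraNneq iss => <-.
rewrite rev_cat rev_cons -cats1 !sweep_cat /= fix_f ?mem_rev// sweep_adjoint.
by rewrite revK fix_f.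
Qed.

Lemma inner_ge0 u : 0 <= inner u u.
Proof.
apply: sumr_ge0 => c _; rewrite -mulrA -normCK.
by rewrite mulr_ge0 ?exprn_ge0// ltW// ltcR.
Qed.

Lemma inner_polarization_ge u f : inner u f + inner f u - inner f f <= inner u u.
Proof.
have e : inner (fun c => (-1) * f c + u c) (fun c => (-1) * f c + u c) =
    inner u u - (inner u f + inner f u - inner f f).
  by rewrite innerDl !innerDr rmorphN1; ring.
by rewrite -subr_ge0 -e inner_ge0.
Qed.

(** Test function: the centred indicator f of the event. With u the image of f
    under the backward pass, the Rayleigh quotient of f has numerator
    <u, u> >= 2 Re <u, f> - <f, f>, and <u, f> only sees the resampling of
    site i, which costs [leave_mass]. *)
Lemma gibbs_rate_ge_leave : 0 < site_mass < 1 ->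
  2 * leave_mass < site_mass * (1 - site_mass) ->
  1 - 2 * leave_mass / (site_mass * (1 - site_mass)) <= gibbs_rate pi.
Proof.
set a := site_mass => /andP[a0 a1] small.
have aa0 : 0 < a * (1 - a) by rewrite mulr_gt0// subr_gt0.
pose h (c : alloc B K) : R[i] := (Q (c i))%:R.
pose f : alloc B K -> R[i] := fun c => (- a%:C) * 1 + h c.
have h1 : inner h (fun=> 1) = a%:C.
  rewrite /dot /a /site_mass realC_sum [RHS]big_mkcond; apply: eq_bigr => c _.
  by rewrite conjC1 mulr1 /h; case: (Q _); rewrite ?mulr1 ?mulr0.
have h1' : inner (fun=> 1) h = a%:C by rewrite innerC h1 realC_conj.
have hh : inner h h = a%:C.
  rewrite -h1; apply: eq_bigr => c _; rewrite /h; case: (Q _); rewrite ?conjC1//.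
  by rewrite !mulr0 !mul0r.
have rh1 : inner (rs i h) (fun=> 1) = a%:C by rewrite resample_self_adjoint resample_cst.
have rhh : inner (rs i h) h = stay_mass%:C.
  rewrite /dot /stay_mass realC_sum [RHS]big_mkcond; apply: eq_bigr => c _.
  rewrite /h; case: (Q (c i)); rewrite ?conjC0 ?mulr0// conjC1 mulr1.
  rewrite realCM realC_sum /resample [in RHS]big_mkcond; congr (_ * _).
  apply: eq_bigr => k _; rewrite update_same; case: (Q k); rewrite ?mulr1 ?mulr0//.
have one1 : inner (fun=> 1) (fun=> 1) = 1 by rewrite inner_cstE normr1 expr1n.
have Na : (- a%:C)^*%R = - a%:C by rewrite rmorphN/= realC_conj.
have ff : inner f f = (a * (1 - a))%:C.
  rewrite innerDl !innerDr one1 h1 h1' hh Na realCM rmorphB rmorph1/=; ring.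
have rff : inner (rs i f) f = (stay_mass - a ^+ 2)%:C.
  rewrite resample_linear resample_cst innerDl !innerDr one1 h1' rh1 rhh Na.
  rewrite rmorphB rmorphXn/=; ring.
pose u := sweep pi (rev (enum 'I_B)) f.
have uf : inner u f = (stay_mass - a ^+ 2)%:C.
  by rewrite -rff; exact: (inner_sweep_site (fun k => (- a%:C) * 1 + (Q k)%:R)).
have fu : inner f u = (stay_mass - a ^+ 2)%:C by rewrite innerC uf realC_conj.
have uu : (2 * (stay_mass - a ^+ 2) - a * (1 - a))%:C <= inner u u.
  apply: le_trans (inner_polarization_ge u f); rewrite ff uf fu.
  rewrite -rmorphD -rmorphB lecR/=; lra.
apply: (@gibbs_rate_ge_rayleigh f).
- apply/mean_zeroE; rewrite innerDl one1 h1; ring.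
- by rewrite subr_gt0 ltr_pdivrMr// mul1r.
- by rewrite ff ltcR.
rewrite ff /gibbs_operator sweep_cat sweep_adjoint -/u.
apply: le_trans uu; rewrite -realCM lecR le_eqVlt; apply/orP; left; apply/eqP.
by rewrite stay_leave -/a; field; rewrite !gt_eqF ?subr_gt0.
Qed.

End GibbsSpectrum.

(** * Domination by constant allocations *)

Section PairDomination.
Variables (R : realType) (B K : nat) (w : alloc B K -> R).
Hypothesis w_gt0 : forall c, 0 < w c.

(** A single quantity that bounds the weight of every non-constant allocation
    relative to each constant allocation that it can be merged into. *)
Definition defect : R :=
  \sum_(c : alloc B K) \sum_(k | (k \in codom c) && (c != const_alloc B k))
    w c / w (const_alloc B k).

Lemma mass_le_defect (E E' : pred (alloc B K)) :
  (forall c, E c -> exists k, [/\ k \in codom c, c != const_alloc B k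
     & E' (const_alloc B k)]) ->
  \sum_(c : alloc B K | E c) w c <= defect * \sum_(c : alloc B K | E' c) w c.
Proof.
move=> EE'; have r0 c c' : 0 <= w c / w c' by rewrite divr_ge0// ltW.
have S0 : 0 <= \sum_(c : alloc B K | E' c) w c by apply: sumr_ge0 => *; exact: ltW.
rewrite /defect mulr_suml big_mkcond; apply: ler_sum => c _.
case: ifP => [/EE'[k [kc ck Ek]]|_]; last by rewrite mulr_ge0// sumr_ge0.
rewrite (bigD1 k) ?kc ?ck//= mulrDl.
rewrite -[leLHS]addr0; apply: lerD; last first.
  by apply: mulr_ge0 => //; apply: sumr_ge0.
rewrite mulrAC -mulrA ler_peMr ?(ltW (w_gt0 _))// ler_pdivlMr// mul1r.
by rewrite (bigD1 (const_alloc B k))//= lerDl sumr_ge0// => *; exact: ltW.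
Qed.

Lemma defect_ge0 : 0 <= defect.
Proof. by apply: sumr_ge0 => c _; apply: sumr_ge0 => k _; rewrite divr_ge0// ltW. Qed.

Lemma normalize_gt0 (c0 : alloc B K) c : 0 < normalize w c.
Proof.
rewrite divr_gt0// (bigD1 c0)//= ltr_pwDl// sumr_ge0// => *; exact: ltW.
Qed.

Lemma normalize_sum1 (c0 : alloc B K) : \sum_c normalize w c = 1.
Proof.
rewrite -mulr_suml divff// gt_eqF// (bigD1 c0)//= ltr_pwDl//.
by rewrite sumr_ge0// => *; exact: ltW.
Qed.

Variables (i j : 'I_B) (k' : nat).
Hypotheses (ij : i != j) (k'_range : (1 <= k' < K)%N).

Local Notation low := (fun k : 'I_K => (k < k')%N).

Lemma sum_pair_weight (P P' : pred 'I_K) :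
  \sum_(l | P l) \sum_(m | P' m) pair_weight w i j l m =
  \sum_(c : alloc B K | P (c i) && P' (c j)) w c.
Proof.
rewrite (partition_big (fun c : alloc B K => c i) P)/=; last by move=> c /andP[].
apply: eq_bigr => l Pl.
rewrite (partition_big (fun c : alloc B K => c j) P')/=; last by move=> c /andP[/andP[]].
apply: eq_bigr => m Pm; apply: eq_bigl => c.
by case: eqP => [->|]; case: eqP => [->|]; rewrite ?Pl ?Pm ?andbF.
Qed.

Lemma pair_mass (P P' : pred 'I_K) :
  pair_norm w i j * \sum_(l | P l) \sum_(m | P' m) pair_weight w i j l m =
  \sum_(c : alloc B K | P (c i) && P' (c j)) normalize w c.
Proof.
by rewrite /pair_norm !sum_pair_weight /normalize -mulr_suml mulrC.
Qed.

Let mass (P P' : pred 'I_K) := \sum_(c : alloc B K | P (c i) && P' (c j)) normalize w c.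

Local Notation high := (fun k : 'I_K => (k' <= k)%N).

Lemma p11E : p11 w i j k' = mass low low. Proof. exact: pair_mass. Qed.
Lemma p12E : p12 w i j k' = mass low high. Proof. exact: pair_mass. Qed.
Lemma p21E : p21 w i j k' = mass high low. Proof. exact: pair_mass. Qed.
Lemma p22E : p22 w i j k' = mass high high. Proof. exact: pair_mass. Qed.

(** Mixed allocations are charged to the constant allocations on the component of
    site i or of site j. *)
Lemma mass_mixed_le (P P' Q : pred 'I_K) :
  (forall c : alloc B K, P (c i) && P' (c j) ->
     (c i != c j) && (Q (c i) || Q (c j))) ->
  mass P P' <= defect * mass Q Q.
Proof.
move=> PQ; rewrite /mass /normalize -!mulr_suml mulrA ler_wpM2r//.
  by rewrite invr_ge0 sumr_ge0// => *; exact: ltW.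
apply: mass_le_defect => c /PQ /andP[cij Qc].
have nc k : c != const_alloc B k.
  by apply: contraNneq cij => ->; rewrite !ffunE.
case/orP: Qc => Qc; [exists (c i)|exists (c j)];
  by rewrite codom_f nc !ffunE Qc.
Qed.

Lemma mass_diag_gt0 (Q : pred 'I_K) k : Q k -> 0 < mass Q Q.
Proof.
move=> Qk; rewrite /mass (bigD1 (const_alloc B k)) ?ffunE ?Qk//=.
have pi0 := normalize_gt0 (const_alloc B k).
by rewrite ltr_pwDl// sumr_ge0// => *; exact: ltW.
Qed.

Let k'_pos : (0 < k')%N. Proof. by case/andP: k'_range. Qed.
Let k'_lt : (k' < K)%N. Proof. by case/andP: k'_range. Qed.
Let K_pos : (0 < K)%N. Proof. exact: ltn_trans k'_pos k'_lt. Qed.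

Lemma p11_gt0 : 0 < p11 w i j k'.
Proof. by rewrite p11E; apply: (@mass_diag_gt0 _ (Ordinal K_pos)). Qed.

Lemma p22_gt0 : 0 < p22 w i j k'.
Proof. by rewrite p22E; apply: (@mass_diag_gt0 _ (Ordinal k'_lt)) => /=. Qed.

Let mixed (c : alloc B K) : low (c i) && high (c j) || high (c i) && low (c j) ->
  c i != c j.
Proof.
by apply: contraTneq => ->; case: leqP.
Qed.

Lemma p12_le_p11 : p12 w i j k' <= defect * p11 w i j k'.
Proof.
rewrite p12E p11E; apply: mass_mixed_le => c h.
by rewrite mixed ?h//; case/andP: h => ->.
Qed.

Lemma p12_le_p22 : p12 w i j k' <= defect * p22 w i j k'.
Proof.
rewrite p12E p22E; apply: mass_mixed_le => c h.
by rewrite mixed ?h//; case/andP: h => _ ->; rewrite orbT.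
Qed.

Lemma p21_le_p11 : p21 w i j k' <= defect * p11 w i j k'.
Proof.
rewrite p21E p11E; apply: mass_mixed_le => c h.
by rewrite mixed ?h ?orbT//; case/andP: h => _ ->; rewrite orbT.
Qed.

Lemma p21_le_p22 : p21 w i j k' <= defect * p22 w i j k'.
Proof.
rewrite p21E p22E; apply: mass_mixed_le => c h.
by rewrite mixed ?h ?orbT//; case/andP: h => ->.
Qed.

Let mass_ge0 P P' : 0 <= mass P P'.
Proof.
by apply: sumr_ge0 => c _; exact/ltW/(normalize_gt0 c).
Qed.

Lemma p_sum1 : p11 w i j k' + p12 w i j k' + (p21 w i j k' + p22 w i j k') = 1.
Proof.
rewrite p11E p12E p21E p22E -(@normalize_sum1 (const_alloc B (Ordinal K_pos))).
rewrite [RHS](bigID (fun c : alloc B K => low (c i)))/=.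
rewrite [X in _ = X + _](bigID (fun c : alloc B K => low (c j)))/=.
rewrite [X in _ = _ + X](bigID (fun c : alloc B K => low (c j)))/=.
by rewrite /mass; congr (_ + _ + (_ + _)); apply: eq_bigl => c; rewrite -?leqNgt.
Qed.

(** The quotient equals 1 - p21 / (p21 + p22) - p12 / (p11 + p12). *)
Lemma pair_ratio_bounds :
  1 - 2 * defect <= (p11 w i j k' - p1_ w i j k' * p_1 w i j k')
     / ((p11 w i j k' + p12 w i j k') * (p21 w i j k' + p22 w i j k')) <= 1.
Proof.
have := p_sum1; have dl0 := defect_ge0; rewrite /p1_ /p_1.
have a0 := p11_gt0; have d0 := p22_gt0.
have b0 : 0 <= p12 w i j k' by rewrite p12E.
have c0 : 0 <= p21 w i j k' by rewrite p21E.
have bd := p12_le_p11; have cd := p21_le_p22.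
move: (p11 _ _ _ _) (p12 _ _ _ _) (p21 _ _ _ _) (p22 _ _ _ _) a0 d0 b0 c0 bd cd.
move=> a b c d a0 d0 b0 c0 bd cd s1.
have ab : 0 < a + b by rewrite ltr_pwDl.
have dc : 0 < c + d by rewrite ltr_wpDl.
have -> : (a - (a + b) * (a + c)) / ((a + b) * (c + d)) =
    1 - c / (c + d) - b / (a + b).
  have -> : a - (a + b) * (a + c) = a * (a + b + (c + d)) - (a + b) * (a + c).
    by rewrite s1 mulr1.
  by field; rewrite !gt_eqF.
have hc : c / (c + d) <= defect.
  by rewrite ler_pdivrMr// (le_trans cd)// ler_wpM2l// lerDr.
have hb : b / (a + b) <= defect.
  by rewrite ler_pdivrMr// (le_trans bd)// ler_wpM2l// lerDl.
have c1 : 0 <= c / (c + d) by rewrite divr_ge0// ltW.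
have b1 : 0 <= b / (a + b) by rewrite divr_ge0// ltW.
by apply/andP; split; lra.
Qed.

(** The mass leaving the event c i < k' is at most p12 + p21, which is at most
    2 * defect times each of the masses of the event and of its complement. *)
Lemma gibbs_rate_bounds : 8 * defect < 1 ->
  1 - 8 * defect <= gibbs_rate (normalize w) <= 1.
Proof.
move=> small; have dl0 := defect_ge0; have c0 := const_alloc B (Ordinal K_pos).
have pi0 := normalize_gt0 c0; have pi1 := normalize_sum1 c0.
apply/andP; split; last exact: gibbs_rate_le1.
have lowN k : ~~ low k = high k by rewrite -leqNgt.
have am : site_mass (normalize w) i low = p11 w i j k' + p12 w i j k'.
  rewrite p11E p12E /site_mass (bigID (fun c : alloc B K => low (c j)))/=.
  by congr (_ + _); apply: eq_bigl => c; rewrite lowN.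
have lm : leave_mass (normalize w) i low <= p12 w i j k' + p21 w i j k'.
  apply: le_trans (@leave_mass_le _ _ _ _ pi0 i low j ij) _; rewrite p12E p21E lerD//.
    by rewrite /mass le_eqVlt; apply/orP; left; apply/eqP/eq_bigl => c; rewrite lowN.
  by rewrite /mass le_eqVlt; apply/orP; left; apply/eqP/eq_bigl => c; rewrite lowN.
have := @gibbs_rate_ge_leave _ _ _ _ pi0 pi1 i low; rewrite am.
have -> : 1 - (p11 w i j k' + p12 w i j k') = p21 w i j k' + p22 w i j k'.
  by rewrite -p_sum1; ring.
have s1 := p_sum1.
have a0 := p11_gt0; have d0 := p22_gt0.
have b0 : 0 <= p12 w i j k' by rewrite p12E.
have c0' : 0 <= p21 w i j k' by rewrite p21E.
have bd := p12_le_p11; have bd' := p12_le_p22.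
have cd := p21_le_p22; have cd' := p21_le_p11.
move: (p11 _ _ _ _) (p12 _ _ _ _) (p21 _ _ _ _) (p22 _ _ _ _)
  (leave_mass _ _ _) lm a0 d0 b0 c0' bd bd' cd cd' s1.
move=> a b c d l lm a0 d0 b0 c0' bd bd' cd cd' s1 H.
have ab : 0 < a + b by rewrite ltr_pwDl.
have dc : 0 < c + d by rewrite ltr_wpDl.
have key : 2 * l <= 8 * defect * ((a + b) * (c + d)).
  have : b + c <= 2 * defect * (a + b).
    have : defect * a <= defect * (a + b) by rewrite ler_wpM2l// lerDl.
    lra.
  have : b + c <= 2 * defect * (c + d).
    have : defect * d <= defect * (c + d) by rewrite ler_wpM2l// lerDr.
    lra.
  (* The larger of the two masses is at least 1 / 2, so that the smaller one is
     at most twice their product. *)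
  have [h|h] := leP (1 / 2) (a + b) => h1 h2.
    have : 2 * defect * (c + d) <= 2 * (a + b) * (2 * defect * (c + d)).
      rewrite ler_peMl ?mulr_ge0// ?(ltW dc)//; lra.
    have -> : 2 * (a + b) * (2 * defect * (c + d)) = 4 * defect * ((a + b) * (c + d)) by ring.
    lra.
  have : 2 * defect * (a + b) <= 2 * (c + d) * (2 * defect * (a + b)).
    rewrite ler_peMl ?mulr_ge0// ?(ltW ab)//; lra.
  have -> : 2 * (c + d) * (2 * defect * (a + b)) = 4 * defect * ((a + b) * (c + d)) by ring.
  lra.
have abdc : 0 < (a + b) * (c + d) by rewrite mulr_gt0.
apply: le_trans (H _ _).
- by rewrite lerD2l lerN2 ler_pdivrMr.
- by apply/andP; split; lra.
- by rewrite (le_lt_trans key)// -[ltRHS]mul1r ltr_pM2r.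
Qed.

End PairDomination.

Theorem theorem5 (R : realType) (D N B K : nat)
    (Y : 'I_N -> 'cV[R]_D) (b : 'I_B -> 'I_N) (C : 'I_N -> 'I_K)
    (Sigma0 : 'M[R]_D) (beta nu0 : R) (i j : 'I_B) (k' : nat)
    (T : Type) (F : filter_on T) (FF : ProperFilter F) (d : T -> 'I_K -> R)
    (hK : (2 < K)%N) (hB : (2 < B)%N) (hb : injective b) (hij : i != j)
    (hSigma0 : posdefmx Sigma0) (hbeta : 0 < beta) (hnu0 : 0 < nu0)
    (hGamma : forall (c : alloc B K) (k : 'I_K) (r : nat), (1 <= r <= D)%N ->
       0 < nu0 + (n_unblocked b C k + n_blocked c k)%:R + 1 - r%:R)
    (hY : 2^-1 *: (Y (b i) + Y (b j)) = 0)
    (hn : forall k, (0 < n_unblocked b C k)%N)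
    (hS : forall k, S_unblocked Y b C Sigma0 k \in unitmx)
    (hYbar : forall k, Ybar_unblocked Y b C k != 0)
    (hd0 : forall t k, 0 < d t k)
    (hd : forall k, d t k @[t --> F] --> +oo)
    (hdO : forall l m, (fun t => d t l : R^o) =O_F (fun t => d t m : R^o))
    (hk' : (1 <= k' < K)%N) :
  let w t := weight Y b C Sigma0 beta nu0 (d t) in
  ((p11 (w t) i j k' - p1_ (w t) i j k' * p_1 (w t) i j k')
     / ((p11 (w t) i j k' + p12 (w t) i j k')
        * (p21 (w t) i j k' + p22 (w t) i j k')) @[t --> F] --> (1 : R))
  /\ (gibbs_rate (normalize (w t)) @[t --> F] --> (1 : R)).
Proof.
move=> w.
have w_gt0 t c : 0 < w t c by exact: weight_gt0.
have d_comparable l m : exists M : R, \forall t \near F, d t l <= M * d t m.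
  have /eqOP/filter_ex[M HM] := hdO l m; exists M.
  by apply: filterS HM => t; rewrite !gtr0_norm.
have defect_to0 : defect (w t) @[t --> F] --> (0 : R).
  have -> : (0 : R) = \sum_(c : alloc B K)
      \sum_(k | (k \in codom c) && (c != const_alloc B k)) 0.
    by rewrite big1// => c _; rewrite big1.
  apply: cvg_big => [|c _]; first exact: add_continuous.
  apply: cvg_big => [|k /andP[kc ck]]; first exact: add_continuous.
  exact: weight_ratio_to0.
have lower (x : R) : 1 - x * defect (w t) @[t --> F] --> (1 : R).
  suff : 1 - x * defect (w t) @[t --> F] --> 1 - x * 0 by rewrite mulr0 subr0.
  by apply: cvgB; [exact: cvg_cst|apply: cvgM => //; exact: cvg_cst].
split.
- apply: (@squeeze_cvgr _ _ _ _ (fun t => 1 - 2 * defect (w t)) (fun=> 1)).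
  + by near=> t; exact: pair_ratio_bounds.
  + exact: lower.
  + exact: cvg_cst.
- apply: (@squeeze_cvgr _ _ _ _ (fun t => 1 - 8 * defect (w t)) (fun=> 1)).
  + near=> t; apply: gibbs_rate_bounds hij hk' _ => //.
    rewrite -subr_gt0; near: t; exact: (cvgr_gt _ (lower 8)).
  + exact: lower.
  + exact: cvg_cst.
Unshelve. all: by end_near. Qed.
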